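(* Let $p$ be a prime number and let $f,g\in\mathbf{Z}_p[x]$ be two monic polynomials of degree at least $1$. Then the ideal of $\mathbf{Z}_p[x]$ generated by $f$ and $g$ equals $\mathbf{Z}_p[x]$ if and only if the ideal of $(\mathbf{Z}/p\mathbf{Z})[x]$ generated by $\widetilde{f}_1$ and $\widetilde{g}_1$ equals $(\mathbf{Z}/p\mathbf{Z})[x]$.
   Context: $\mathbf{Z}_p=\varprojlim \mathbf{Z}/p^k\mathbf{Z}$ is the ring of $p$-adic integers. For $h\in\mathbf{Z}_p[x]$, $\widetilde{h}_1$ denotes the image of $h$ in $(\mathbf{Z}/p\mathbf{Z})[x]$ obtained by applying the natural projection $\mathbf{Z}_p\rightarrow\mathbf{Z}/p\mathbf{Z}$ to the coefficients of $h$. *)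

(* Defs.v *)
From HB Require Import structures.
From mathcomp Require Import all_boot all_algebra.
From mathcomp Require Import boolp classical_sets.

Set Implicit Arguments.
Unset Strict Implicit.
Unset Printing Implicit Defensive.

Import GRing.Theory.
Local Open Scope ring_scope.

(* The library predicate [idealr_closed] only describes proper ideals, so it
   cannot express that an ideal is the whole ring. *)
Definition is_ideal (R : comNzRingType) (I : set R) : Prop :=
  [/\ I 0,
      forall x y, I x -> I y -> I (x + y)
    & forall a x, I x -> I (a * x)].

Definition ideal_generated (R : comNzRingType) (G : set R) : set R :=
  smallest (@is_ideal R) G.

Lemma dvdn_Zp_trunc (p j k : nat) : (j <= k)%N ->
  ((Zp_trunc (p ^ j.+1)).+2 %| (Zp_trunc (p ^ k.+1)).+2)%N.
Proof.
move=> jk; have [p1|] := ltnP 1 p; last first.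
  by case: p => [|[|//]] _; rewrite ?exp0n ?exp1n.
by rewrite !Zp_cast ?(ltn_exp2l 0) ?dvdn_exp2l.
Qed.

(* The projection Z/p^(k+1) -> Z/p^(j+1); meaningful only for [j <= k]. *)
Definition Zp_proj (p k j : nat) (x : 'Z_(p ^ k.+1)) : 'Z_(p ^ j.+1) :=
  inZp x.

Section ZpProj.
Variables (p j k : nat).
Hypothesis jk : (j <= k)%N.

Let inZp_modn n : inZp (n %% (Zp_trunc (p ^ k.+1)).+2) = inZp n
  :> 'Z_(p ^ j.+1).
Proof. by apply: val_inj; rewrite /= modn_dvdm ?dvdn_Zp_trunc. Qed.

Lemma Zp_projD : {morph @Zp_proj p k j : x y / x + y}.
Proof.
by move=> x y; rewrite /Zp_proj inZp_modn; apply: val_inj; rewrite /= modnDm.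
Qed.

Lemma Zp_projM : {morph @Zp_proj p k j : x y / x * y}.
Proof.
by move=> x y; rewrite /Zp_proj inZp_modn; apply: val_inj; rewrite /= modnMm.
Qed.

Lemma Zp_proj0 : Zp_proj j (0 : 'Z_(p ^ k.+1)) = 0.
Proof. exact: val_inj. Qed.

Lemma Zp_proj1 : Zp_proj j (1 : 'Z_(p ^ k.+1)) = 1.
Proof. by rewrite /Zp_proj inZp_modn. Qed.

Lemma Zp_projN : {morph @Zp_proj p k j : x / - x}.
Proof.
by move=> x; apply: (addrI (Zp_proj j x)); rewrite -Zp_projD !subrr Zp_proj0.
Qed.

End ZpProj.

Definition padic_compatible (p : nat) (u : forall k, 'Z_(p ^ k.+1)) :=
  forall j k, (j <= k)%N -> Zp_proj j (u k) = u j.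

(* The ring of p-adic integers, as the projective limit of the rings Z/p^k.
   The component of index [k] lives in Z/p^(k+1): the trivial ring Z/p^0 is
   left out, since ['Z_1] is not trivial but Z/2. For the same reason [padic p]
   has its usual meaning only for [1 < p]. *)
Record padic (p : nat) := Padic {
  padic_val :> forall k, 'Z_(p ^ k.+1);
  padic_valP : padic_compatible padic_val
}.

Lemma padicP (p : nat) (x y : padic p) : (forall k, x k = y k) -> x = y.
Proof.
case: x y => [x xP] [y yP] /= xy.
have {}xy : x = y by apply: functional_extensionality_dep.
by rewrite {x}xy in xP *; congr Padic; apply: Prop_irrelevance.
Qed.

HB.instance Definition _ (p : nat) := gen_eqMixin (padic p).
HB.instance Definition _ (p : nat) := gen_choiceMixin (padic p).

Section PadicRing.
Variable p : nat.
Implicit Types x y z : padic p.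

Fact padic_zero_subproof : @padic_compatible p (fun=> 0).
Proof. by move=> j k jk; rewrite Zp_proj0. Qed.
Definition padic_zero := Padic padic_zero_subproof.

Fact padic_one_subproof : @padic_compatible p (fun=> 1).
Proof. by move=> j k jk; rewrite Zp_proj1. Qed.
Definition padic_one := Padic padic_one_subproof.

Fact padic_opp_subproof x : padic_compatible (fun k => - x k).
Proof. by move=> j k jk; rewrite Zp_projN ?padic_valP. Qed.
Definition padic_opp x := Padic (padic_opp_subproof x).

Fact padic_add_subproof x y : padic_compatible (fun k => x k + y k).
Proof. by move=> j k jk; rewrite Zp_projD ?padic_valP. Qed.
Definition padic_add x y := Padic (padic_add_subproof x y).

Fact padic_mul_subproof x y : padic_compatible (fun k => x k * y k).
Proof. by move=> j k jk; rewrite Zp_projM ?padic_valP. Qed.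
Definition padic_mul x y := Padic (padic_mul_subproof x y).

Fact padic_addA : associative padic_add.
Proof. by move=> x y z; apply: padicP => k /=; rewrite addrA. Qed.
Fact padic_addC : commutative padic_add.
Proof. by move=> x y; apply: padicP => k /=; rewrite addrC. Qed.
Fact padic_add0 : left_id padic_zero padic_add.
Proof. by move=> x; apply: padicP => k /=; rewrite add0r. Qed.
Fact padic_addN : left_inverse padic_zero padic_opp padic_add.
Proof. by move=> x; apply: padicP => k /=; rewrite addNr. Qed.

HB.instance Definition _ :=
  GRing.isZmodule.Build (padic p) padic_addA padic_addC padic_add0 padic_addN.

Fact padic_mulA : associative padic_mul.
Proof. by move=> x y z; apply: padicP => k /=; rewrite mulrA. Qed.
Fact padic_mulC : commutative padic_mul.
Proof. by move=> x y; apply: padicP => k /=; rewrite mulrC. Qed.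
Fact padic_mul1 : left_id padic_one padic_mul.
Proof. by move=> x; apply: padicP => k /=; rewrite mul1r. Qed.
Fact padic_mulD : left_distributive padic_mul +%R.
Proof. by move=> x y z; apply: padicP => k /=; rewrite mulrDl. Qed.
Fact padic_one_neq0 : padic_one != 0.
Proof.
by apply/eqP => /(congr1 (fun x : padic p => x 0%N)) /= /eqP; rewrite oner_eq0.
Qed.

HB.instance Definition _ :=
  GRing.Zmodule_isComNzRing.Build (padic p)
    padic_mulA padic_mulC padic_mul1 padic_mulD padic_one_neq0.

End PadicRing.

(* Well-typed since [p ^ 1] is convertible to [p]. *)
Definition padic_modp (p : nat) (x : padic p) : 'Z_p := x 0%N.

Fact padic_modp_is_zmod_morphism (p : nat) : zmod_morphism (@padic_modp p).
Proof. by []. Qed.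
Fact padic_modp_is_monoid_morphism (p : nat) : monoid_morphism (@padic_modp p).
Proof. by []. Qed.

HB.instance Definition _ (p : nat) :=
  GRing.isZmodMorphism.Build (padic p) 'Z_p (@padic_modp p)
    (@padic_modp_is_zmod_morphism p).
HB.instance Definition _ (p : nat) :=
  GRing.isMonoidMorphism.Build (padic p) 'Z_p (@padic_modp p)
    (@padic_modp_is_monoid_morphism p).

Definition poly_modp (p : nat) (h : {poly padic p}) : {poly 'Z_p} :=
  map_poly (@padic_modp p) h.

(* Main.v *)
Require Import Defs.
From mathcomp Require Import all_boot all_algebra.
From mathcomp Require Import boolp classical_sets.
From mathcomp Require Import zify.

(** Two nonconstant monic polynomials [f] and [g] over a commutative ring
    generate the unit ideal exactly when their resultant is invertible.  One
    implication is the classical fact that the resultant lies in the ideal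
    generated by [f] and [g] ([resultant_in_ideal]).  For the other
    ([resultant_unit]), the rows of the Sylvester matrix are the coefficient
    vectors of the [X^i f] and the [X^j g]; if [u f + v g = 1], Euclidean
    division by the monic [f] turns this into a representation of every monomial
    [X^i] of degree less than [deg f + deg g] by cofactors of bounded degree
    ([bounded_cofactors]), that is, into a left inverse of the Sylvester matrix.

    Reduction modulo [p] preserves the degree of a monic polynomial, hence
    commutes with the resultant ([map_resultant_monic]).  A p-adic integer is
    invertible as soon as its residue modulo [p] is ([padic_inv_exists]), so the
    resultant is invertible over the p-adic integers when it is so modulo [p].
    The opposite direction of the equivalence is the reduction of a relation
    [u f + v g = 1]. *)

Set Implicit Arguments.
Unset Strict Implicit.

Import GRing.Theory.
Import Pdiv.Ring Pdiv.RingMonic.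

Local Open Scope ring_scope.

Lemma ideal_generated2_eqT (R : comNzRingType) (a b : R) :
  ideal_generated [set a; b]%classic = [set: R]%classic <->
  exists u v, u * a + v * b = 1.
Proof.
split=> [abT | [u [v uv1]]].
- pose I : set R := [set x | exists u v, u * a + v * b = x]%classic.
  have I_ideal : is_ideal I.
    split=> [|x y [u [v <-]] [u' [v' <-]]|c x [u [v <-]]].
    + by exists 0, 0; rewrite !mul0r addr0.
    + by exists (u + u'), (v + v'); rewrite !mulrDl addrACA.
    + by exists (c * u), (c * v); rewrite mulrDr !mulrA.
  have : ideal_generated [set a; b]%classic 1 by rewrite abT.
  move=> /(_ I); apply; split=> // x [] ->.
  + by exists 1, 0; rewrite mul1r mul0r addr0.
  + by exists 0, 1; rewrite mul1r mul0r add0r.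
- rewrite -subTset => x _ I [[_ ID IM] abI].
  rewrite -[x]mulr1 -uv1; apply/IM/ID; apply/IM/abI; [by left|by right].
Qed.

(** A relation [u * p + v * q = r] can be shortened: replacing [v] by its
    remainder modulo the monic [p] bounds the degree of [v], and then the
    equation itself bounds the degree of [u]. *)
Lemma bounded_cofactors (R : comNzRingType) (p q u v r : {poly R}) :
  p \is monic -> u * p + v * q = r ->
  (size r <= (size q).-1 + (size p).-1)%N ->
  exists u' v' : {poly R},
    [/\ (size u' <= (size q).-1)%N, (size v' <= (size p).-1)%N
      & u' * p + v' * q = r].
Proof.
move=> p_monic uv_r size_r.
pose v' : {poly R} := rmodp v p; pose u' : {poly R} := u + rdivp v p * q.
have size_v' : (size v' < size p)%N by rewrite ltn_rmodpN0 ?monic_neq0.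
have u'v'_r : u' * p + v' * q = r.
  rewrite -uv_r [in RHS](rdivp_eq p_monic v) -/v' /u' !mulrDl addrA.
  by congr (_ + _ + _); rewrite -!mulrA [q * p]mulrC.
exists u', v'; split=> //; last by lia.
have [->|u'_neq0] := eqVneq u' 0; first by rewrite size_poly0.
have : (size (u' * p)%R <= (size q).-1 + (size p).-1)%N.
  have size_v'q : (size (v' * q)%R <= (size v' + size q).-1)%N.
    exact: size_polyMleq.
  have -> : u' * p = r - v' * q by rewrite -u'v'_r addrK.
  rewrite (leq_trans (size_polyD _ _)) // geq_max size_r size_polyN.
  by rewrite (leq_trans size_v'q) //; lia.
have -> : size (u' * p)%R = (size u' + size p).-1 by rewrite size_Mmonic.
by lia.
Qed.

(** Over a field this is the non-vanishing of the resultant of coprime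
    polynomials.  Over a ring it takes a left inverse of the Sylvester matrix:
    its rows are the bounded cofactors that represent the monomials. *)
Lemma resultant_unit (R : comNzRingType) (p q u v : {poly R}) :
  p \is monic -> u * p + v * q = 1 -> exists s, s * resultant p q = 1.
Proof.
move=> p_monic uv1.
have row_inv (i : 'I_((size q).-1 + (size p).-1)) :
    exists w : 'rV_(_), w *m Sylvester_mx p q = delta_mx 0 i.
  have uvXi : ('X^i * u) * p + ('X^i * v) * q = 'X^i.
    by rewrite -!mulrA -mulrDr uv1 mulr1.
  have [|u' [v' [size_u' size_v' u'v'Xi]]] := bounded_cofactors p_monic uvXi.
    by rewrite size_polyXn.
  exists (row_mx (poly_rV u') (poly_rV v')).
  rewrite mul_row_col !mul_rV_lin1 /= !poly_rV_K // -linearD /=.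
  by rewrite u'v'Xi -rVpoly_delta rVpolyK.
have [W WS] := fin_all_exists row_inv.
exists (\det (\matrix_i W i)); rewrite -det_mulmx.
suff -> : (\matrix_i W i) *m Sylvester_mx p q = 1%:M by rewrite det1.
by apply/row_matrixP => i; rewrite row_mul rowK WS row1.
Qed.

(** [map_resultant] concerns morphisms out of a polynomial ring.  It applies to
    [phi] composed with evaluation at [0], and to that evaluation alone, at the
    polynomials [p] and [q] with their coefficients viewed as constants. *)
Lemma map_resultant_monic (R S : comNzRingType) (phi : {rmorphism R -> S})
    (p q : {poly R}) : p \is monic -> q \is monic ->
  phi (resultant p q) = resultant (map_poly phi p) (map_poly phi q).
Proof.
move=> p_monic q_monic; pose ev0 : {rmorphism {poly R} -> R} := horner_eval 0.
have lead1 (h : {poly R}) : h \is monic -> lead_coef (map_poly polyC h) = 1.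
  by move=> h_monic; apply/monicP/monic_map.
have map_const (T : comNzRingType) (psi : {rmorphism R -> T}) (h : {poly R}) :
    map_poly (psi \o ev0) (map_poly polyC h) = map_poly psi h.
  by apply/polyP => i; rewrite !coef_map /= /horner_eval hornerC.
have map_res (T : comNzRingType) (psi : {rmorphism R -> T}) :
    psi (ev0 (resultant (map_poly polyC p) (map_poly polyC q))) =
    resultant (map_poly psi p) (map_poly psi q).
  have psi_lead h : h \is monic ->
      (psi \o ev0) (lead_coef (map_poly polyC h)) != 0.
    by move=> h_monic; rewrite lead1 // rmorph1 oner_neq0.
  have := map_resultant (psi_lead _ p_monic) (psi_lead _ q_monic).
  by rewrite !map_const.
have := map_res R idfun; rewrite !map_poly_id // => <-; exact: map_res.
Qed.

Lemma coprime_padic_comp (p k : nat) (x : padic p) : prime p ->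
  padic_modp x \is a GRing.unit -> coprime (p ^ k.+1) (x k).
Proof.
move=> p_prime; have p_gt1 := prime_gt1 p_prime.
have <- : Zp_proj 0 (x k) = padic_modp x by rewrite padic_valP.
rewrite -[Zp_proj 0 (x k)]natr_Zp unitZpE // => p_coprime.
apply: coprimeXl; move: p_coprime => /=.
by rewrite [(Zp_trunc (p ^ 1)).+2]Zp_cast ?expn1 // coprime_modr.
Qed.

(** The residue modulo [p] decides whether each component is prime to [p], and
    the inverses of the components are compatible because inverses are unique
    and projections are multiplicative. *)
Lemma padic_inv_exists (p : nat) (x : padic p) : prime p ->
  padic_modp x \is a GRing.unit -> exists y, y * x = 1.
Proof.
move=> p_prime x_unit; have p_gt1 := prime_gt1 p_prime.
have xk_unit k : x k \is a GRing.unit.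
  rewrite -[x k]natr_Zp unitZpE ?coprime_padic_comp //.
  by rewrite -(exp1n k.+1) ltn_exp2r.
have inv_compat : padic_compatible (fun k => (x k)^-1).
  move=> j k jk; apply: (mulIr (xk_unit j)).
  rewrite mulVr ?xk_unit //; have <- := padic_valP x jk.
  by rewrite -Zp_projM // mulVr ?xk_unit // Zp_proj1.
by exists (Padic inv_compat); apply: padicP => k /=; rewrite mulVr ?xk_unit.
Qed.

Theorem theorem7 (p : nat) (p_prime : prime p) (f g : {poly padic p})
    (f_monic : f \is monic) (g_monic : g \is monic)
    (f_deg : (1 <= (size f).-1)%N) (g_deg : (1 <= (size g).-1)%N) :
  ideal_generated [set f; g]%classic = [set: {poly padic p}]%classic <->
  ideal_generated [set poly_modp f; poly_modp g]%classic =
    [set: {poly 'Z_p}]%classic.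
Proof.
rewrite !ideal_generated2_eqT; split=> [[u [v uv1]]|[u [v uv1]]].
  exists (poly_modp u), (poly_modp v).
  by rewrite -!rmorphM -rmorphD uv1 rmorph1.
have fp_monic : poly_modp f \is monic := monic_map _ f_monic.
have [s s_res] := resultant_unit fp_monic uv1.
have res_unit : padic_modp (resultant f g) \is a GRing.unit.
  apply/unitrPr; exists s; rewrite mulrC.
  by rewrite map_resultant_monic.
have [y y_res] := padic_inv_exists p_prime res_unit.
have size_f : (1 < size f)%N by lia.
have size_g : (1 < size g)%N by lia.
have [[a b] _ res_ab] := resultant_in_ideal size_f size_g.
exists (y%:P * a), (y%:P * b).
by rewrite -!mulrA -mulrDr -res_ab -polyCM y_res.
Qed.
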